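(* Let $F_{\mathbb N}$ be a skew-periodic interval map with reflective boundary, with base map $F_0$, step length function $\psi$ and reflexion rule $\psi_1$ as in the context, and let $g:\mathfrak R_0\to\mathbb R_{<0}$ be Hölder continuous. Then $$\mathcal P(g,\mathbb N)=\inf_{q\le0}\mathcal P(g+q\psi).$$
   Context: Conventions: $\mathbb N=\{0,1,2,\dots\}$. Pressures take values in $[-\infty,+\infty]$. Base map. $I\subset\mathbb N$ with $\mathrm{card}(I)\ge 2$ (finite or countably infinite), $(J_i)_{i\in I}$ are non-empty pairwise disjoint open subintervals of $(0,1)$, $\Delta_0=\bigcup_{i\in I}J_i$, and $F_0:\Delta_0\to(0,1)$ satisfies: $F_0(J_i)=(0,1)$ for every $i$; each $F_0|_{J_i}$ has a $C^2$-extension to a neighbourhood of $\overline{J_i}$; $\inf_{\Delta_0}|F_0'|>1$; $\sup_{\Delta_0}|F_0''|/(F_0')^2<\infty$. Step functions. $\psi:\Delta_0\to\mathbb Z$ is constant on each $J_i$, with $\inf\psi=-1<0<\sup\psi\le\infty$. $\psi_1:\Delta_0\to\mathbb N$ is constant on each $J_i$ with $\psi\le\psi_1\le\psi+M$ for some $M>0$. Extensions. $F_{\mathbb Z}:\Delta_0+\mathbb Z\to\mathbb R$, $F_{\mathbb Z}(x)=F_0(x-\lfloor x\rfloor)+\psi(x-\lfloor x\rfloor)+\lfloor x\rfloor$. $F_{\mathbb N}:\Delta_0+\mathbb N\to\mathbb R$, $F_{\mathbb N}(x)=F_0(x)+\psi_1(x)$ if $x\in(0,1)$ and $F_{\mathbb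 N}(x)=F_0(x-\lfloor x\rfloor)+\psi(x-\lfloor x\rfloor)+\lfloor x\rfloor$ if $x>1$. For a map $f$ with domain $\Delta\subset\mathbb R$: $\mathfrak R(f)=\bigcap_{n\ge0}f^{-n}(\Delta)$ and $\mathrm{Per}_n(f)=\{x\in\mathfrak R(f):f^n(x)=x\}$. It is assumed that $F_{\mathbb Z}$ and $F_{\mathbb N}$ are topologically transitive on their repellers $\mathfrak R(\cdot)$ (for all non-empty relatively open $U,V$ there is $n\in\mathbb N$ with $f^n(U)\cap V\ne\emptyset$). Write $\mathfrak R_0=\mathfrak R(F_0)$; then $\mathfrak R(F_{\mathbb N})=\mathfrak R_0+\mathbb N$. Pressures. A function $g:\mathfrak R_0\to\mathbb R$ is called Hölder continuous if its restrictions to $\mathfrak R_0\cap J_i$ are Hölder continuous with exponent and constant independent of $i$. For such $g$ put $\mathcal P(g)=\limsup_{n}\frac1n\log\sum_{x\in\mathrm{Per}_n(F_0)\cap J_i}\exp\big(\sum_{k=0}^{n-1}g(F_0^k(x))\big)$ and $\mathcal P(g,\mathbb N)=\limsup_{n}\frac1n\log\sum_{x\in\mathrm{Per}_n(F_{\mathbb N})\cap (J_i+h)}\exp\big(\sum_{k=0}^{n-1}g_{\mathbb N}(F_{\mathbb N}^k(x))\big)$, where $g_{\mathbb N}(x)=g(x-\lfloor x\rfloor)$; these do not depend on $i\in I$, $h\in\mathbb N$. *)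

(* Defs.v *)
From HB Require Import structures.
From mathcomp Require Export all_boot all_order all_algebra.
From mathcomp Require Export all_classical all_reals all_analysis.

Set Implicit Arguments.
Unset Strict Implicit.
Unset Printing Implicit Defensive.

Import Order.TTheory GRing.Theory Num.Theory.
Import numFieldNormedType.Exports.

Local Open Scope classical_set_scope.
Local Open Scope ring_scope.

(* A map with domain D is represented by a total function f : R -> R together
   with the set D; values of f outside D are never used. *)
Section PartialMaps.
Variable R : realType.
Implicit Types (D A U V : set R) (f g : R -> R).

(* Intersecting over all n makes this the same set whether iter n f is read as
   the iterate of the total function or of the partial map on D. *)
Definition repeller D f : set R := \bigcap_(n : nat) (iter n f @^-1` D).

Definition Per D f (n : nat) : set R :=
  [set x | repeller D f x /\ iter n f x = x].

(* Open sets of the repeller are the traces of open sets of R. *)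
Definition top_transitive D f : Prop :=
  forall U V, open U -> open V ->
    U `&` repeller D f !=set0 -> V `&` repeller D f !=set0 ->
    exists n : nat,
      (iter n f @` (U `&` repeller D f)) `&` (V `&` repeller D f) !=set0.

(* limsup_n (1/n) log (sum over the n-periodic points in A of exp(S_n g)), in
   [-oo, +oo], with log 0 = -oo and log +oo = +oo; the n = 0 term is
   irrelevant. *)
Definition periodic_pressure D f A g : \bar R :=
  limn_esup (fun n : nat =>
    ((n%:R^-1)%:E *
     lne (\esum_(x in Per D f n `&` A)
            (expR (\sum_(k < n) g (iter k f x)))%:E))%E).

Definition C2_on U (G : R -> R) : Prop :=
  forall x, U x ->
    [/\ derivable G x 1, derivable (derive1 G) x 1
      & {for x, continuous (derive1n 2 G)}].

Definition frac (x : R) : R := x - (Num.floor x)%:~R.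

End PartialMaps.

Section SkewPeriodic.
Variable R : realType.
Variables (I : set nat) (J : nat -> set R).
Variables (F0 : R -> R) (psi : R -> int) (psi1 : R -> nat).

Definition Delta0 : set R := \bigcup_(i in I) J i.

Record base_map : Prop := BaseMap {
  base_card : (`I_2 #<= I)%card;
  base_itv : forall i, I i ->
    [/\ J i !=set0, open (J i), is_interval (J i) & J i `<=` `]0, 1[%classic];
  base_disj : trivIset I J;
  base_full : forall i, I i -> F0 @` J i = `]0, 1[%classic;
  base_C2 : forall i, I i -> exists (U : set R) (G : R -> R),
    [/\ open U, closure (J i) `<=` U, C2_on U G
      & forall x, J i x -> G x = F0 x];
  base_expand :
    (1 < ereal_inf [set `|derive1 F0 x|%:E | x in Delta0])%E;
  base_adler :
    (ereal_sup [set (`|derive1n 2 F0 x| / (derive1 F0 x) ^+ 2)%:E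
               | x in Delta0] < +oo)%E
}.

Record step_length : Prop := StepLength {
  step_cst : forall i, I i -> forall x y, J i x -> J i y -> psi x = psi y;
  step_inf : ereal_inf [set ((psi x)%:~R : R)%:E | x in Delta0] = (-1)%:E;
  step_sup : (0 < ereal_sup [set ((psi x)%:~R : R)%:E | x in Delta0])%E
}.

Record reflexion_rule : Prop := ReflexionRule {
  refl_cst : forall i, I i -> forall x y, J i x -> J i y -> psi1 x = psi1 y;
  refl_bound : exists2 M : int, 0 < M &
    forall x, Delta0 x -> psi x <= (psi1 x)%:Z <= psi x + M
}.

Definition DeltaZ : set R := [set x + k%:~R | x in Delta0 & k in [set: int]].
Definition DeltaN : set R := [set x + k%:R | x in Delta0 & k in [set: nat]].

Definition FZ (x : R) : R :=
  F0 (frac x) + (psi (frac x))%:~R + (Num.floor x)%:~R.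

(* The integer point 1 is not in DeltaN. *)
Definition FN (x : R) : R :=
  if x < 1 then F0 x + (psi1 x)%:R else FZ x.

Record skew_periodic_reflective : Prop := SkewPeriodicReflective {
  skew_base : base_map;
  skew_step : step_length;
  skew_refl : reflexion_rule;
  skew_transZ : top_transitive DeltaZ FZ;
  skew_transN : top_transitive DeltaN FN
}.

Definition R0 : set R := repeller Delta0 F0.

Definition holder_on_branches (g : R -> R) : Prop :=
  exists a C : R, [/\ 0 < a, a <= 1 &
    forall i, I i -> forall x y, (R0 `&` J i) x -> (R0 `&` J i) y ->
      `|g x - g y| <= C * `|x - y| `^ a].

Definition pressure (i : nat) (g : R -> R) : \bar R :=
  periodic_pressure Delta0 F0 (J i) g.

Definition pressureN (i h : nat) (g : R -> R) : \bar R :=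
  periodic_pressure DeltaN FN [set x + h%:R | x in J i] (fun x => g (frac x)).

End SkewPeriodic.

(* Main.v *)
Require Import Defs.
From mathcomp Require Import lra ring zify.

Set Implicit Arguments.
Unset Strict Implicit.
Unset Printing Implicit Defensive.

Import Order.TTheory GRing.Theory Num.Theory.
Import numFieldNormedType.Exports.

Local Open Scope classical_set_scope.
Local Open Scope ring_scope.

(** Code orbits of [F0] by words over [I]. Along a closed path of [FN] the true
    steps dominate [psi], so the Birkhoff sum of [psi] is nonpositive and
    tilting by [q * psi] with [q <= 0] only increases the weight: this gives
    [<=].

    For [>=], a word with nonpositive [psi]-sum has a rotation all of whose
    suffixes have nonpositive sum; started at level 0 the reflected walk driven
    by it ends at a bounded level, and connecting words of bounded length close
    it up. So [P(g, N)] dominates the exponential growth rate of the total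
    weight of words with nonpositive [psi]-sum. That rate is the infimum over
    [q <= 0] of the tilted pressures: by supermultiplicativity the normalised
    weight of the words of length [n] and sum [k] is at most [exp (lambda * k)]
    for a single slope [lambda >= 0], and [q] slightly below [- lambda] does it.

    A word need not have a periodic point, as the fixed point of its inverse
    branch may be 0 or 1. Inserting a fixed word whose cylinder stays away from
    0 and 1 cures this at bounded cost. *)

(** * Words and one-sided duality *)

Section Words.
Variables (T : choiceType) (I : set T).
Definition word (w : seq T) : Prop := forall a, a \in w -> I a.

Lemma word_nil : word [::]. Proof. by []. Qed.

Lemma word_cons a w : I a -> word w -> word (a :: w).
Proof. by move=> Ia ww b; rewrite inE => /orP[/eqP->|/ww]. Qed.

Lemma word_behead a w : word (a :: w) -> word w.
Proof. by move=> ww b bw; apply: ww; rewrite inE bw orbT. Qed.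

Lemma word_cat u v : word u -> word v -> word (u ++ v).
Proof. by move=> wu wv b; rewrite mem_cat => /orP[/wu|/wv]. Qed.

Lemma word_nseq a n : I a -> word (nseq n a).
Proof. by move=> Ia b /nseqP[->]. Qed.

Lemma word_rot m w : word w -> word (rot m w).
Proof. by move=> ww b; rewrite mem_rot => /ww. Qed.
End Words.

(** By Bernoulli's inequality the powers of a number above 1 are unbounded. This turns bounds up to
    a constant, valid for all repetitions of a block of words, into sharp ones. *)
Lemma bounded_powers_le1 (R : realType) (x K : R) (n0 : nat) :
  (forall t : nat, (n0 <= t)%N -> x ^+ t <= K) -> x <= 1.
Proof.
move=> xK; rewrite leNgt; apply/negP => x1.
have xE : x = 1 + (x - 1) by ring.
have y0 : 0 < x - 1 by rewrite subr_gt0.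
have B t : 1 + (x - 1) *+ t <= x ^+ t.
  elim: t => [|t IH]; first by rewrite mulr0n addr0 expr0.
  rewrite exprS; apply: le_trans (ler_wpM2l (ltW (lt_trans ltr01 x1)) IH).
  have h1 : 0 <= (x - 1) *+ t by apply: mulrn_wge0; apply: ltW.
  by rewrite mulrSr; nra.
pose t := maxn n0 (Num.trunc (`|K| / (x - 1))).+1.
have := xK t (leq_maxl _ _); rewrite leNgt => /negP; apply.
apply: lt_le_trans (B t).
have : `|K| / (x - 1) < t%:R.
  apply: lt_le_trans (Num.Theory.truncnS_gt _) _.
  by rewrite ler_nat leq_maxr.
rewrite ltr_pdivrMr// mulrC mulr_natr => h.
by apply: (le_lt_trans (ler_norm K)); apply: (lt_trans h); rewrite ltrDr.
Qed.

Lemma geometric_sum_le (R : realType) (x : R) (N : nat) :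
  0 <= x -> x < 1 -> \sum_(k < N) x ^+ k <= (1 - x)^-1.
Proof.
move=> x0 x1; have y0 : 0 < 1 - x by rewrite subr_gt0.
rewrite -[leRHS]mul1r ler_pdivlMr//.
have -> : (\sum_(k < N) x ^+ k) * (1 - x) = 1 - x ^+ N.
  by have := subrX1 x N => e; rewrite -[1 - x]opprB mulrN mulrC -e opprB.
by rewrite gerBl exprn_ge0.
Qed.

Section Duality.
Variables (R : realType) (T : choiceType) (I : set T).
Variables (W : seq T -> R) (s : T -> int) (C : R) (i0 : T).
Hypotheses (W_gt0 : forall w, 0 < W w) (C_gt0 : 0 < C).
Hypothesis W_cat : forall u v, word I u -> word I v ->
  W u * W v <= C * W (u ++ v).
Hypotheses (s_ge : forall a, I a -> -1 <= s a) (I_i0 : I i0) (s_i0 : s i0 = -1).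

Definition wsum (w : seq T) : int := \sum_(a <- w) s a.

Lemma wsum_cat u v : wsum (u ++ v) = wsum u + wsum v.
Proof. exact: big_cat. Qed.

Lemma wsum_cons a v : wsum (a :: v) = s a + wsum v.
Proof. exact: big_cons. Qed.

Lemma wsum_nil : wsum [::] = 0. Proof. exact: big_nil. Qed.

Lemma wsum_ge w : word I w -> - (size w)%:Z <= wsum w.
Proof.
elim: w => [|a w IH] ww; first by rewrite wsum_nil.
rewrite wsum_cons /= -addn1 PoszD opprD addrC.
by rewrite lerD ?IH ?s_ge//; [apply: ww; rewrite mem_head|exact: word_behead ww].
Qed.

Variables (K beta : R) (n0 : nat).
Hypothesis bound : forall (n : nat) (X : seq (seq T)), (n0 <= n)%N -> uniq X ->
  (forall w, w \in X -> [/\ word I w, size w = n & wsum w <= 0]) ->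
  \sum_(w <- X) W w <= K * expR (beta * n%:R).

Definition block (n : nat) (k : int) (X : seq (seq T)) : Prop :=
  uniq X /\ forall w, w \in X -> [/\ word I w, size w = n & wsum w = k].

(* Dividing by [C] makes the normalised mass supermultiplicative. *)
Definition nmass (n : nat) (X : seq (seq T)) : R :=
  (\sum_(w <- X) W w) / (C * expR (beta * n%:R)).

(** A lower bound [x] is recorded rather than the mass itself: the relation is then stable under
    products, although concatenation gives only an inequality between masses. *)
Definition attained (n : nat) (k : int) (x : R) : Prop :=
  0 <= x /\ exists2 X, block n k X & x <= nmass n X.

Lemma block_cat n k X n' k' Y : block n k X -> block n' k' Y ->
  block (n + n')%N (k + k') [seq u ++ v | u <- X, v <- Y].
Proof.
move=> [uX bX] [uY bY]; split; last first.
  move=> w /allpairsP[[u v]] /= [/bX[wu su ku] /bY[wv sv kv] ->].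
  by rewrite size_cat su sv wsum_cat ku kv; split => //; exact: word_cat.
(* Concatenation is injective here because all words of [X] have the same length. *)
apply: allpairs_uniq => // -[u v] [u' v'] /= /allpairsP[[a b]] /= [aX bY' [-> ->]].
move=> /allpairsP[[a' b']] /= [a'X b'Y [-> ->]] /eqP.
have [_ sa _] := bX _ aX; have [_ sa' _] := bX _ a'X.
by rewrite eqseq_cat ?sa ?sa'// => /andP[/eqP-> /eqP->].
Qed.

Lemma nmass_cat n k X n' k' Y : block n k X -> block n' k' Y ->
  nmass n X * nmass n' Y <= nmass (n + n') [seq u ++ v | u <- X, v <- Y].
Proof.
move=> [_ bX] [_ bY]; rewrite /nmass.
have e0 (m : nat) : 0 < expR (beta * m%:R) :> R by exact: expR_gt0.
rewrite mulf_div natrD mulrDr expRD.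
rewrite ler_pdivrMr; last by rewrite !mulr_gt0.
set E := expR _; set E' := expR _.
rewrite (_ : _ * (C * E * (C * E')) =
   C * \sum_(w <- [seq u ++ v | u <- X, v <- Y]) W w); last first.
  by rewrite /E /E'; field; rewrite !gt_eqF//= ?e0.
rewrite big_allpairs_dep /= mulr_suml mulr_sumr.
rewrite big_seq [leRHS]big_seq; apply: ler_sum => u uX.
rewrite mulr_sumr mulr_sumr big_seq [leRHS]big_seq; apply: ler_sum => v vY.
by have [? _ _] := bX _ uX; have [? _ _] := bY _ vY; exact: W_cat.
Qed.

Lemma attainedM n k x n' k' y : attained n k x -> attained n' k' y ->
  attained (n + n') (k + k') (x * y).
Proof.
move=> [x0 [X bX xX]] [y0 [Y bY yY]]; split; first exact: mulr_ge0.
exists [seq u ++ v | u <- X, v <- Y]; first exact: block_cat.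
by apply: le_trans (nmass_cat bX bY); exact: ler_pM.
Qed.

Lemma attainedX n k x t : attained n k x ->
  attained (n * t.+1) (k * (t.+1)%:Z) (x ^+ t.+1).
Proof.
move=> h; elim: t => [|t IH]; first by rewrite muln1 mulr1 expr1.
by rewrite mulnS exprS intS mulrDr mulr1; exact: attainedM.
Qed.

Lemma attained_bounded n k x : attained n k x -> k <= 0 -> (n0 <= n)%N ->
  x <= K / C.
Proof.
move=> [x0 [X [uX bX] xX]] k0 n0n; apply: (le_trans xX); rewrite /nmass.
have e0 : 0 < expR (beta * n%:R) :> R by exact: expR_gt0.
rewrite ler_pdivrMr ?mulr_gt0//.
rewrite mulrA divfK ?gt_eqF//; apply: bound => // w /bX[ww sw kw].
by rewrite kw.
Qed.

(** Repeating a block keeps its sum nonpositive, so all high powers of [x] obey the same bound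
    [K / C]. *)
Lemma attained_le1 n k x : attained n k x -> (0 < n)%N -> k <= 0 -> x <= 1.
Proof.
move=> h n_gt0 k0; apply: (@bounded_powers_le1 _ _ (K / C) n0.+1) => -[//|t] n0t.
apply: (attained_bounded (attainedX t h)).
  by rewrite mulr_le0_ge0.
by rewrite (leq_trans _ (leq_pmull _ n_gt0))// ltnW.
Qed.

(** Joining [k'.+1] copies of the first block with [k.+1] copies of the second makes the total sum
    vanish. *)
Lemma attained_opposite n (k : nat) x n' (k' : nat) y : (0 < n)%N ->
  attained n k.+1%:Z x -> attained n' (- k'.+1%:Z) y ->
  x ^+ k'.+1 * y ^+ k.+1 <= 1.
Proof.
move=> n_gt0 hx hy.
apply: (attained_le1 (attainedM (attainedX k' hx) (attainedX k hy))).
  by rewrite addn_gt0 muln_gt0 n_gt0.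
by rewrite mulNr mulrC subrr.
Qed.

Let c0 : R := W [:: i0] / (C * expR beta).

Lemma c0_gt0 : 0 < c0.
Proof. by rewrite divr_gt0// mulr_gt0// expR_gt0. Qed.

Lemma attained_descent : attained 1 (-1) c0.
Proof.
split; first exact/ltW/c0_gt0.
exists [:: [:: i0]]; last by rewrite /nmass big_seq1 mulr1.
split=> // w; rewrite inE => /eqP->; split=> //; last by rewrite /wsum big_seq1.
by move=> a; rewrite inE => /eqP->.
Qed.

(** Exponential rates of mass per unit of positive sum; their supremum is the slope [lambda].
    Including 0 makes the set nonempty and [lambda] nonnegative. *)
Let slopes : set R := [set 0] `|` [set y | exists n (k : nat) x,
  [/\ (0 < n)%N, attained n k.+1%:Z x, 0 < x & y = ln x / k.+1%:R]].

(** This is the logarithm of [attained_opposite]: each block of negative sum bounds the slopes of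
    all blocks of positive sum. For the slope 0 it suffices that [y <= 1]. *)
Lemma slopes_bound n k y : (0 < n)%N -> attained n (- k.+1%:Z) y -> 0 < y ->
  ubound slopes (- (ln y / k.+1%:R)).
Proof.
move=> n_gt0 hy y0 z [->|[n' [k' [x [n'0 hx x0 ->]]]]].
  rewrite oppr_ge0 pmulr_lle0 ?invr_gt0//.
  by apply: ln_le0; apply: (attained_le1 hy) => //; rewrite oppr_le0.
have := attained_opposite n'0 hx hy; rewrite -ler_ln ?posrE ?mulr_gt0 ?exprn_gt0//.
rewrite lnM ?posrE ?exprn_gt0// !lnXn// ln1.
rewrite -[ln x *+ _]mulr_natr -[ln y *+ _]mulr_natr => h.
rewrite ler_pdivrMr// -mulNr mulrAC ler_pdivlMr//; lra.
Qed.

Lemma slopes_has_sup : has_sup slopes.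
Proof.
split; first by exists 0; left.
(* The single letter [i0], a block of length 1 and sum -1, makes the supremum finite. *)
exists (- (ln c0 / 1%:R)); apply: (@slopes_bound 1%N 0%N) => //.
  exact: attained_descent.
exact: c0_gt0.
Qed.

Let lambda := sup slopes.

Lemma lambda_ge0 : 0 <= lambda.
Proof. by apply: sup_upper_bound; [exact: slopes_has_sup|left]. Qed.

(** For positive [k] this is the definition of the supremum, for [k = 0] it is [attained_le1], and
    for negative [k] the block itself gives an upper bound of all slopes. *)
Lemma attained_le_slope n (k : int) x : (0 < n)%N -> attained n k x ->
  x <= expR (lambda * k%:~R).
Proof.
move=> n_gt0 hx.
have := hx.1; rewrite le_eqVlt => /predU1P[<-|x0]; first exact: expR_ge0.
rewrite -[leLHS]lnK ?posrE// ler_expR.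
case: k hx => [[|k]|k] hx.
- by rewrite mulr0; apply: ln_le0; exact: (attained_le1 hx).
- rewrite -ler_pdivrMr ?ltr0z// -pmulrn; apply: sup_upper_bound.
    exact: slopes_has_sup.
  by right; exists n, k, x.
- rewrite NegzE in hx *; rewrite mulrNz mulrN lerNr -pmulrn.
  rewrite -ler_pdivlMr// mulNr; apply: ge_sup; first by exists 0; left.
  exact: slopes_bound hx x0.
Qed.

(** A block of sum [k - n] weighs at most [C * expR (beta * n + lambda * (k - n))]. Tilting by
    [q = - (lambda + eps)] leaves [C * expR ((beta + eps) * n)] times [expR (- eps * k)], the term
    of a geometric series in [k]. *)
Theorem one_sided_duality (eps : R) : 0 < eps -> exists q K' : R, q <= 0 /\
  forall (n : nat) (X : seq (seq T)), (0 < n)%N -> uniq X ->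
  (forall w, w \in X -> word I w /\ size w = n) ->
  \sum_(w <- X) W w * expR (q * (wsum w)%:~R)
    <= K' * expR ((beta + eps) * n%:R).
Proof.
move=> eps0; pose r := expR (- eps); pose q := - (lambda + eps).
exists q, (C / (1 - r)); split.
  by rewrite oppr_le0 addr_ge0 ?lambda_ge0// ltW.
move=> n X n_gt0 uX wX.
(* Shifting by [n] makes the sums natural numbers, since each letter contributes at least -1. *)
pose kap (w : seq T) : nat := `|(wsum w + n%:Z)%R|%N.
have kapE w : w \in X -> wsum w = (kap w)%:Z - n%:Z.
  move=> /wX[ww sw]; rewrite /kap gez0_abs ?addrK//.
  by rewrite -lerBlDr sub0r -sw; exact: wsum_ge.
(* [N] depends on [X], but the bound on the geometric sum is uniform in the number of terms. *)
pose N := (\max_(w <- X) kap w)%N.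
have kapN w : w \in X -> (kap w < N.+1)%N.
  by move=> wX'; rewrite ltnS; apply: leq_bigmax_seq.
rewrite (partition_big (fun w => inord (kap w) : 'I_N.+1) xpredT)//=.
have step (k : 'I_N.+1) :
  \sum_(w <- X | inord (kap w) == k) W w * expR (q * (wsum w)%:~R) <=
  C * expR ((beta + eps) * n%:R) * r ^+ k.
  pose Y := [seq w <- X | inord (kap w) == k].
  have kY w : w \in Y -> wsum w = k%:Z - n%:Z.
    rewrite mem_filter => /andP[/eqP <- wX']; rewrite inordK ?kapN//.
    exact: kapE.
  have bY : block n (k%:Z - n%:Z) Y.
    split; first exact: filter_uniq.
    move=> w wY; rewrite kY//; split => //;
    by move: wY; rewrite mem_filter => /andP[_ /wX[]].
  have : nmass n Y <= expR (lambda * (k%:Z - n%:Z)%:~R).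
    apply: (@attained_le_slope n) => //; split; last by exists Y.
    rewrite /nmass divr_ge0 ?sumr_ge0 ?mulr_ge0 ?expR_ge0 ?(ltW C_gt0)//.
    by move=> w _; exact: ltW.
  rewrite /nmass ler_pdivrMr ?mulr_gt0 ?expR_gt0// => h.
  rewrite -big_filter -/Y big_seq.
  under eq_bigr => w wY do rewrite kY//.
  rewrite -big_seq -mulr_suml.
  apply: le_trans (ler_wpM2r (expR_ge0 _) h) _.
  rewrite /r -expRM_natl [X in X * _]mulrCA -!mulrA ler_pM2l//.
  rewrite -!expRD ler_expR /q rmorphB /= -!pmulrn.
  by lra.
apply: le_trans (ler_sum _ (fun k _ => step k)) _.
rewrite -mulr_sumr [leRHS]mulrAC ler_wpM2l//.
  by rewrite mulr_ge0 ?expR_ge0// ltW.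
apply: geometric_sum_le; first exact: expR_ge0.
by rewrite /r expR_lt1 oppr_lt0.
Qed.
End Duality.

(** * The reflected walk *)

(** Above level 0 the value [l + s] is already nonnegative when [-1 <= s], so [absz] merely converts
    it to [nat]. *)
Definition reflect_step (s : int) (s1 l : nat) : nat :=
  if l is 0%N then s1 else absz (l%:Z + s).

Lemma reflect_step_pos (s : int) (s1 l : nat) : -1 <= s -> (0 < l)%N ->
  (reflect_step s s1 l)%:Z = l%:Z + s.
Proof. by case: l => // l s1' _ /=; lia. Qed.

Lemma reflect_step_ge (s : int) (s1 l : nat) : -1 <= s -> s <= s1%:Z ->
  l%:Z + s <= (reflect_step s s1 l)%:Z.
Proof.
by move=> s0 ss1; case: (posnP l) => [->|l0]; rewrite ?add0r// reflect_step_pos.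
Qed.

Section ReflectedWalk.
Variables (T : choiceType) (I : set T) (s : T -> int) (s1 : T -> nat) (M : int).
Hypothesis s_ge : forall a, I a -> -1 <= s a.
Hypothesis s1_le : forall a, I a -> (s1 a)%:Z <= s a + M.

Definition walk (w : seq T) (l : nat) : nat :=
  foldl (fun l a => reflect_step (s a) (s1 a) l) l w.

Lemma walk_cat u v l : walk (u ++ v) l = walk v (walk u l).
Proof. exact: foldl_cat. Qed.

Lemma walk_descent i0 l : s i0 = -1 -> walk (nseq l i0) l = 0%N.
Proof.
move=> s0; elim: l => //= l IH; rewrite s0.
by rewrite (_ : absz (l.+1%:Z + -1) = l) //; lia.
Qed.

(** A letter read at level 0 leads at most [M] above its free step, and the sum of the suffix
    starting with that letter is nonpositive; so after a reflexion the walk ends at or below [M]. *)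
Lemma walk_le w l : word I w -> (forall m, wsum s (drop m w) <= 0) ->
  (walk w l)%:Z <= Num.max (l%:Z + wsum s w) M.
Proof.
elim: w l => [|a w IH] l ww sw; first by rewrite wsum_nil addr0 le_max lexx.
have Ia : I a by apply: ww; rewrite mem_head.
have := IH (reflect_step (s a) (s1 a) l) (word_behead ww) (fun m => sw m.+1).
move=> /= /le_trans; apply; rewrite ge_max !le_max lexx orbT andbT.
have := sw 0%N; rewrite drop0 wsum_cons => sw0.
case: (posnP l) => [->|l0] /=; apply/orP; last first.
  by left; rewrite reflect_step_pos ?s_ge// addrA.
by right; have := s1_le Ia; lia.
Qed.

Lemma wsum_drop m w : wsum s (drop m w) = wsum s w - wsum s (take m w).
Proof. by rewrite -{2}(cat_take_drop m w) wsum_cat addrC addKr. Qed.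

(* Rotate so that the word ends where its partial sums are minimal. *)
Lemma rot_nonpositive_suffixes w : wsum s w <= 0 ->
  exists2 m, (m <= size w)%N & forall k, wsum s (drop k (rot m w)) <= 0.
Proof.
move=> sw.
have [m _ mmin] := @arg_minP _ _ _ (ord0 : 'I_(size w).+1) xpredT
  (fun m : 'I_(size w).+1 => wsum s (take m w)) isT.
have {}mmin k : wsum s (take m w) <= wsum s (take k w).
  case: (leqP k (size w)) => [kw|kw].
    exact: (mmin (Ordinal (kw : (k < (size w).+1)%N))).
  rewrite (@take_oversize _ k) ?(ltnW kw)//.
  by have := mmin ord_max isT; rewrite /= take_size.
exists m => [|k]; first by rewrite -ltnS.
(* A suffix starting in [drop m w] has sum at most [wsum s w], as the partial sum at [m] is minimal;
   the sum of one starting in [take m w] is that minimum minus another partial sum. *)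
rewrite /rot drop_cat; case: ltnP => _.
  rewrite wsum_cat drop_drop wsum_drop.
  by have := mmin (k + m)%N; lia.
rewrite wsum_drop; set k' := (_ - _)%N.
case: (leqP k' m) => [k'm|mk'].
  by rewrite take_takel//; have := mmin k'; lia.
rewrite [take k' _]take_oversize ?subrr// size_take_min.
by rewrite (leq_trans (geq_minl _ _))// ltnW.
Qed.
End ReflectedWalk.

(** * Exponential growth rates *)

Section Growth.
Variable R : realType.

Lemma esum_le_seq (T : choiceType) (S : set T) (a : T -> R) (c : \bar R) :
  (forall X : seq T, uniq X -> (forall x, x \in X -> S x) ->
    ((\sum_(x <- X) a x)%:E <= c)%E) ->
  (\esum_(x in S) (a x)%:E <= c)%E.
Proof.
move=> H; apply: ge_ereal_sup => _ [A [finA AS] <-].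
rewrite fsbig_finite//= sumEFin; apply: H; first exact: finmap.fset_uniq.
by move=> x; rewrite in_fset_set// inE => /AS.
Qed.

Lemma seq_le_esum (T : choiceType) (S : set T) (a : T -> R) (X : seq T) :
  uniq X -> (forall x, x \in X -> S x) ->
  ((\sum_(x <- X) a x)%:E <= \esum_(x in S) (a x)%:E)%E.
Proof.
move=> uX XS; apply: esum_ge; exists [set` X].
  by split=> [|x /= /XS//]; exact: finite_seq.
rewrite -fsbig_seq//= sumEFin.
by [].
Qed.

(** Absorbs the number of rotation indices of a word of length [n] into an arbitrarily small
    exponential rate. *)
Lemma natr_expR_bound (eps : R) (n : nat) : 0 < eps ->
  n.+1%:R <= (1 + eps^-1) * expR (eps * n%:R).
Proof.
move=> e0; apply: (@le_trans _ _ ((1 + eps^-1) * (1 + eps * n%:R))); last first.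
  by rewrite ler_wpM2l ?expR_ge1Dx// addr_ge0// invr_ge0 ltW.
have -> : (1 + eps^-1) * (1 + eps * n%:R) = (n.+1%:R + eps * n%:R) + eps^-1.
  by rewrite -addn1 natrD; field; rewrite gt_eqF.
by rewrite -addrA lerDl addr_ge0 ?invr_ge0 ?mulr_ge0// ltW.
Qed.

Variable Z : nat -> \bar R.
Let u (n : nat) : \bar R := ((n%:R^-1)%:E * lne (Z n))%E.

(** The equivalence includes infinite and nonpositive [Z n], so empty and divergent sums need no
    separate treatment. *)
Lemma growth_rate_le (n : nat) (c : R) : (0 < n)%N ->
  (u n <= c%:E)%E = (Z n <= (expR (c * n%:R))%:E)%E.
Proof.
move=> n0; rewrite /u; have n0' : 0 < n%:R^-1 :> R by rewrite invr_gt0 ltr0n.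
case: (Z n) => [r| |] /=.
- case: ifPn => r0.
    rewrite gt0_muleNy ?lte_fin// leNye; apply/esym.
    by rewrite lee_fin (le_trans r0)// expR_ge0.
  rewrite -ltNge in r0; rewrite -EFinM !lee_fin mulrC ler_pdivrMr ?ltr0n//.
  by rewrite -ler_expR lnK.
- by rewrite gt0_muley ?lte_fin// !leye_eq.
- by rewrite gt0_muleNy ?lte_fin// !leNye.
Qed.

Lemma limsup_growth_lt (c : R) : (limn_esup u < c%:E)%E ->
  exists n0, forall n, (n0 <= n)%N -> (Z n <= (expR (c * n%:R))%:E)%E.
Proof.
move=> /ereal_inf_lt[_ [V [n0 _ n0V] <-] Vc].
exists n0.+1 => n n0n; rewrite -growth_rate_le; last exact: leq_trans n0n.
apply: le_trans (ltW Vc); apply: ereal_sup_ubound; exists n => //.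
by apply: n0V; rewrite /= ltnW.
Qed.

Lemma limsup_growth_le (K c : R) (n0 : nat) :
  (forall n, (n0 <= n)%N -> (Z n <= (K * expR (c * n%:R))%:E)%E) ->
  (limn_esup u <= c%:E)%E.
Proof.
move=> ZK; apply/lee_addgt0Pr => eps eps0.
(* Beyond [N] one has [K <= eps * n <= expR (eps * n)], so the constant is lost in the rate; the
   successor also makes [n] positive. *)
pose N := maxn n0 (Num.trunc (`|K| / eps)).+1.
apply: (@le_trans _ _ (ereal_sup (u @` [set n | (N <= n)%N]))).
  by apply: ereal_inf_lbound; exists [set n | (N <= n)%N] => //; exists N.
apply: ge_ereal_sup => _ [n /= Nn <-].
have n_gt0 : (0 < n)%N.
  by apply: leq_trans Nn; rewrite /N (leq_trans _ (leq_maxr _ _)).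
rewrite -EFinD growth_rate_le//; apply: (le_trans (ZK n _)).
  by apply: leq_trans Nn; exact: leq_maxl.
rewrite lee_fin mulrDl expRD mulrC ler_pM2l ?expR_gt0//.
apply: le_trans (expR_ge1Dx _).
have : `|K| / eps < n%:R.
  apply: lt_le_trans (truncnS_gt _) _.
  by rewrite ler_nat (leq_trans (leq_maxr n0 _)).
rewrite ltr_pdivrMr// mulrC => h.
apply: (le_trans (ler_norm K)); apply: (le_trans (ltW h)).
by rewrite lerDr.
Qed.
End Growth.

(** * Inverse branches *)

Section NonExpansive.
Variables (R : realType) (U : set R) (f : R -> R).
Hypothesis oU : open U.
Hypothesis nef : forall y z, U y -> U z -> `|f y - f z| <= `|y - z|.

Lemma nonexpansive_continuous y : U y -> {for y, continuous f}.
Proof.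
move=> Uy; have nU : nbhs y U by apply: open_nbhs_nbhs.
apply/cvgrPdist_lt => e e0; near=> z.
apply: (@le_lt_trans _ _ `|y - z|); last by near: z; exact: cvgr_dist_lt.
by apply: nef => //; near: z.
Unshelve. all: by end_near. Qed.

Lemma nonexpansive_within A : A `<=` U -> {within A, continuous f}.
Proof.
move=> AU; apply: continuous_in_subspaceT => y /[!inE] Ay.
exact: nonexpansive_continuous (AU _ Ay).
Qed.
End NonExpansive.

Section Branches.
Variables (R : realType) (I : set nat) (J : nat -> set R) (F0 : R -> R).
Hypothesis hB : base_map I J F0.
Let U01 : set R := `]0, 1[%classic.

Lemma branch_sub i : I i -> J i `<=` U01.
Proof. by move=> /(base_itv hB)[]. Qed.

Lemma branch_unique i j x : I i -> I j -> J i x -> J j x -> i = j.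
Proof. by move=> Ii Ij Jix Jjx; apply: (base_disj hB) => //; exists x. Qed.

Lemma expansion_constant : exists2 kappa : R, 1 < kappa &
  forall x, Delta0 I J x -> kappa <= `|derive1 F0 x|.
Proof.
have := base_expand hB; set e := ereal_inf _ => e1.
have elb x : Delta0 I J x -> (e <= `|derive1 F0 x|%:E)%E.
  by move=> Dx; apply: ereal_inf_lbound; exists x.
case: e e1 elb => [r| |] // e1 elb.
  by exists r => // x /elb.
(* An infinite infimum would mean an empty domain, so any constant above 1 will do. *)
by exists 2 => [|x /elb //]; rewrite ltr1n.
Qed.

(** Near a point of the open set [J i] the map coincides with its smooth extension and inherits the
    derivative. *)
Lemma branch_derivable i x : I i -> J i x -> derivable F0 x 1.
Proof.
move=> Ii Jx; have [U [G [_ clU C2 GF]]] := base_C2 hB Ii.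
have [_ oJ _ _] := base_itv hB Ii.
have [dG _ _] := C2 x (clU _ (subset_closure Jx)).
have nJ : nbhs x (J i) by apply: open_nbhs_nbhs.
by apply: near_eq_derivable dG; near=> y; apply: GF; near: y.
Unshelve. all: by end_near. Qed.

Variable kappa : R.
Hypothesis kappa1 : 1 < kappa.
Hypothesis kappaP : forall x, Delta0 I J x -> kappa <= `|derive1 F0 x|.
Let kappa0 : 0 < kappa := lt_trans ltr01 kappa1.

(** The mean value theorem applies on the segment between [x] and [y], which lies in the interval
    [J i]. *)
Lemma branch_expanding i x y : I i -> J i x -> J i y ->
  kappa * `|x - y| <= `|F0 x - F0 y|.
Proof.
move=> Ii; wlog xy : x y / x <= y.
  move=> H Jx Jy; case: (leP x y) => [xy|/ltW yx]; first exact: H.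
  by rewrite distrC [leRHS]distrC; exact: H.
move=> Jx Jy; have [_ _ itvJ _] := base_itv hB Ii.
have sub z : z \in `[x, y] -> J i z.
  by rewrite in_itv => /= xzy; exact: (itvJ x y).
have [||z zxy eF] := @MVT_segment _ F0 (derive1 F0) x y xy.
- move=> z /subset_itv_oo_cc/sub Jz; rewrite derive1E; apply: DeriveDef => //.
  exact: branch_derivable Ii Jz.
- apply: derivable_within_continuous => z /sub Jz.
  exact: branch_derivable Ii Jz.
rewrite distrC [leRHS]distrC eF normrM ler_wpM2r//.
by apply: kappaP; exists i => //; exact: sub.
Qed.

Definition inv_branch (a : nat) (y : R) : R := xget 0 [set x | J a x /\ F0 x = y].

Lemma inv_branchP a y : I a -> U01 y ->
  J a (inv_branch a y) /\ F0 (inv_branch a y) = y.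
Proof.
move=> Ia; rewrite -[U01](base_full hB Ia) => -[x Jx Fx].
by rewrite /inv_branch; case: xgetP => [z -> //|/(_ x)[]]; split.
Qed.

(** The first letter is applied last, so that the [F0]-orbit of the result reads the letters of [w]
    in order. *)
Definition inv_word (w : seq nat) (y : R) : R := foldr inv_branch y w.

Lemma inv_word_cat u v y : inv_word (u ++ v) y = inv_word u (inv_word v y).
Proof. exact: foldr_cat. Qed.

Lemma inv_word_unit w y : word I w -> U01 y -> U01 (inv_word w y).
Proof.
elim: w => //= a w IH ww Uy; have Ia : I a by apply: ww; rewrite mem_head.
apply: (branch_sub Ia); apply: (inv_branchP Ia _).1.
by apply: IH => //; exact: word_behead ww.
Qed.

Fixpoint follows (w : seq nat) (x : R) : Prop :=
  if w is a :: w' then J a x /\ follows w' (F0 x) else True.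

Lemma follows_inv_word w y : word I w -> U01 y -> follows w (inv_word w y).
Proof.
elim: w => //= a w IH ww Uy; have Ia : I a by apply: ww; rewrite mem_head.
have ww' := word_behead ww.
have [Ja ->] := inv_branchP Ia (inv_word_unit ww' Uy).
by split => //; exact: IH.
Qed.

Lemma iter_inv_word w y : word I w -> U01 y ->
  iter (size w) F0 (inv_word w y) = y.
Proof.
elim: w => // a w IH ww Uy; have Ia : I a by apply: ww; rewrite mem_head.
have ww' := word_behead ww.
rewrite /= -iterS iterSr (inv_branchP Ia (inv_word_unit ww' Uy)).2.
exact: IH.
Qed.

Lemma follows_expanding w x y : word I w -> follows w x -> follows w y ->
  kappa ^+ size w * `|x - y| <= `|iter (size w) F0 x - iter (size w) F0 y|.
Proof.
elim: w x y => [|a w IH] x y ww /=; first by rewrite expr0 mul1r.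
move=> [Jx fx] [Jy fy]; have Ia : I a by apply: ww; rewrite mem_head.
rewrite -!iterS !iterSr; apply: le_trans (IH _ _ (word_behead ww) fx fy).
rewrite exprSr -mulrA ler_wpM2l ?exprn_ge0 ?(ltW kappa0)//.
exact: branch_expanding Ia Jx Jy.
Qed.

Lemma follows_inj w w' x : word I w -> word I w' -> size w = size w' ->
  follows w x -> follows w' x -> w = w'.
Proof.
elim: w w' x => [|a w IH] [|b w'] x //= ww ww' [sw] [Ja fw] [Jb fw'].
have -> : a = b by apply: (branch_unique _ _ Ja Jb);
  [apply: ww|apply: ww']; rewrite mem_head.
by congr cons; apply: IH fw fw' => //; [exact: word_behead ww|exact: word_behead ww'].
Qed.

(** The iterate along [w] expands distances by a factor above 1, so two of its fixed points
    coincide. *)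
Lemma follows_periodic_inj w x y : word I w -> (0 < size w)%N ->
  follows w x -> follows w y ->
  iter (size w) F0 x = x -> iter (size w) F0 y = y -> x = y.
Proof.
move=> ww sw fx fy ex ey; have := follows_expanding ww fx fy.
rewrite ex ey => h; apply/eqP; rewrite -subr_eq0 -normr_le0.
have k1 : 1 < kappa ^+ size w by rewrite exprn_egt1 // -lt0n.
rewrite -(@pmulr_rle0 _ (kappa ^+ size w - 1)) ?subr_gt0//.
by rewrite mulrBl mul1r subr_le0.
Qed.

Lemma inv_word_nonexpansive w y z : word I w -> U01 y -> U01 z ->
  `|inv_word w y - inv_word w z| <= `|y - z|.
Proof.
move=> ww Uy Uz.
have := follows_expanding ww (follows_inv_word ww Uy) (follows_inv_word ww Uz).
rewrite !iter_inv_word//; apply: le_trans.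
by rewrite ler_peMl// exprn_ege1// ltW.
Qed.

Lemma open_U01 : open U01.
Proof. exact: interval_open. Qed.

Lemma inv_word_within w A : word I w -> A `<=` U01 ->
  {within A, continuous (inv_word w)}.
Proof.
move=> ww AU; apply: (nonexpansive_within open_U01) AU => y z.
exact: inv_word_nonexpansive.
Qed.

Lemma inv_branch_inj a y z : I a -> U01 y -> U01 z ->
  inv_branch a y = inv_branch a z -> y = z.
Proof.
by move=> Ia Uy Uz e; rewrite -(inv_branchP Ia Uy).2 e (inv_branchP Ia Uz).2.
Qed.

(* By the intermediate value theorem the image of an interval cannot jump over
   the image of a point outside of it. *)
Lemma inv_branch_side a b y0 y : I a -> I b -> U01 y0 -> ~ J b y0 -> J b y ->
  inv_branch a y0 < inv_branch a y ->
  forall z, J b z -> inv_branch a y0 <= inv_branch a z.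
Proof.
move=> Ia Ib U0 nJ Jy lt z Jz; rewrite leNgt; apply/negP => ltz.
have [_ _ itvJ _] := base_itv hB Ib.
pose l := Num.min y z; pose r := Num.max y z.
have sub t : t \in `[l, r] -> J b t.
  rewrite in_itv /l /r /= => ltr.
  by case: (leP y z) ltr => h; [exact: itvJ|exact: itvJ].
have lr : l <= r by rewrite /l /r ge_min le_max lexx.
have [||c clr ec] := @IVT _ (inv_word [:: a]) l r (inv_branch a y0) lr.
- apply: inv_word_within; first by move=> c; rewrite inE => /eqP->.
  by move=> t /sub /(branch_sub Ib).
- rewrite /l /r /= ge_min le_max; case: (leP y z) => _;
  by rewrite (ltW lt) (ltW ltz) ?orbT.
apply: nJ; rewrite -(inv_branch_inj Ia _ U0 ec); first exact: sub.
exact: branch_sub Ib _ (sub _ clr).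
Qed.

Lemma two_branches : exists a b, [/\ I a, I b & a <> b].
Proof.
have /pcard_leP[f] := base_card hB.
exists (f 0%N), (f 1%N); split; [exact: funS|exact: funS|].
by move=> e; have := @inj _ _ `I_2 f 0%N 1%N; rewrite !inE => /(_ isT isT e).
Qed.

Lemma branch_ordered a b x y : I a -> I b -> a <> b -> J a x -> J b y -> x < y ->
  forall z, J a z -> z <= y.
Proof.
move=> Ia Ib ab Jx Jy xy z Jz; rewrite leNgt; apply/negP => yz.
have [_ _ itvJ _] := base_itv hB Ia; apply: ab.
apply: (branch_unique Ia Ib _ Jy).
by apply: (itvJ x z) => //; rewrite (ltW xy) (ltW yz).
Qed.

(* Two branches produce four cylinders of length two; a middle one stays away
   from both ends of the unit interval. *)
Lemma interior_word : exists v (alpha beta : R),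
  [/\ word I v, (0 < size v)%N, 0 < alpha, beta < 1 &
      forall y, U01 y -> alpha <= inv_word v y <= beta].
Proof.
have [a [b [Ia Ib ab [x [y [Jx Jy xy]]]]]] : exists a b, [/\ I a, I b, a <> b &
    exists x y, [/\ J a x, J b y & x < y]].
  have [a [b [Ia Ib ab]]] := two_branches.
  have [[x Jx] _ _ _] := base_itv hB Ia; have [[y Jy] _ _ _] := base_itv hB Ib.
  case: (ltgtP x y) => [xy|yx|xy]; last first.
  - by case: ab; apply: (branch_unique Ia Ib Jx); rewrite xy.
  - by exists b, a; split => //; [exact: nesym|exists y, x].
  - by exists a, b; split => //; exists x, y.
have Ux := branch_sub Ia Jx; have Uy := branch_sub Ib Jy.
have y1 : y < 1 by move: Uy; rewrite /U01 /= in_itv /= => /andP[].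
have w2 c : I c -> word I [:: a; c].
  by move=> Ic; apply: word_cons => //; apply: word_cons.
(* Since [x] in [J a] lies below [y] in [J b], no point of [J a] exceeds [y]: this gives an upper
   bound below 1 for every word starting with [a]. *)
have up c t : I c -> U01 t -> inv_word [:: a; c] t <= y.
  move=> Ic Ut; apply: (branch_ordered Ia Ib ab Jx Jy xy).
  apply: (inv_branchP Ia _).1; apply: (@inv_word_unit [:: c]) => // d.
  by rewrite inE => /eqP->.
have pos t : U01 t -> 0 < inv_branch a t.
  move=> Ut; have := branch_sub Ia (inv_branchP Ia Ut).1.
  by rewrite /U01 /= in_itv /= => /andP[].
(* The orientation of the branch of [a] decides which second letter keeps the cylinder away from 0:
   [b] if it puts [x] before [y], and [a] if it puts [y] before [x]. *)
case: (ltgtP (inv_branch a x) (inv_branch a y)) => [lt|lt|e].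
- exists [:: a; b], (inv_branch a x), y; split=> //; [exact: w2|exact: pos|].
  move=> t Ut; rewrite up// andbT.
  apply: (inv_branch_side Ia Ib Ux _ Jy lt); last exact: (inv_branchP Ib Ut).1.
  by move=> Jbx; apply: ab; exact: branch_unique Jx Jbx.
- exists [:: a; a], (inv_branch a y), y; split=> //; [exact: w2|exact: pos|].
  move=> t Ut; rewrite up// andbT.
  apply: (inv_branch_side Ia Ia Uy _ Jx lt); last exact: (inv_branchP Ia Ut).1.
  by move=> Jay; apply: ab; exact: branch_unique Jay Jy.
- by move: xy; rewrite (inv_branch_inj Ia Ux Uy e) ltxx.
Qed.

(** * Fixed points of inverse branches *)

Variables (v : seq nat) (alpha beta : R).
Hypotheses (wv : word I v) (alpha0 : 0 < alpha) (beta1 : beta < 1).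
Hypothesis vP : forall y, U01 y -> alpha <= inv_word v y <= beta.

(** The rotated word [v ++ w ++ u] maps the unit interval into the segment from [alpha] to [beta],
    where the intermediate value theorem gives a fixed point. Its image under the inverse branch of
    [u] is fixed for [u ++ v ++ w]. *)
Lemma fixed_point_exists u w : word I u -> word I w ->
  exists2 x, U01 x & inv_word (u ++ v ++ w) x = x.
Proof.
move=> wu ww; pose z := v ++ (w ++ u).
have wz : word I z by apply: word_cat => //; exact: word_cat.
have half : U01 (2^-1) by rewrite /U01 /= in_itv /= invr_gt0 invf_lt1 ?ltr0n ?ltr1n.
have ab : alpha <= beta by have /andP[] := vP half; exact: le_trans.
have zP y : U01 y -> alpha <= inv_word z y <= beta.
  by move=> Uy; rewrite inv_word_cat; apply/vP/inv_word_unit => //; exact: word_cat.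
have sub : `[alpha, beta]%classic `<=` U01.
  by move=> t; rewrite /U01 /= !in_itv /= => /andP[at_ tb];
  rewrite (lt_le_trans alpha0 at_) (le_lt_trans tb beta1).
have Ua : U01 alpha by apply: sub; rewrite /= in_itv /= lexx ab.
have Ub : U01 beta by apply: sub; rewrite /= in_itv /= lexx ab.
have [||y yab ey] := @IVT _ (inv_word z \- id) alpha beta 0 ab.
- move=> t; apply: continuousB; first exact: inv_word_within.
  exact: (continuous_subspaceT (fun t : R => cvg_id)).
- rewrite ge_min le_max /=.
  have /andP[za _] := zP _ Ua; have /andP[_ zb] := zP _ Ub.
  by rewrite !subr_ge0 !subr_le0 za zb orbT.
have {}ey : inv_word z y = y by apply/eqP; rewrite -subr_eq0; apply/eqP.
have Uy : U01 y by exact: sub.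
exists (inv_word u y); first exact: inv_word_unit.
by rewrite -inv_word_cat -!catA -{2}ey -inv_word_cat.
Qed.
End Branches.

(** * Coding and bounded distortion *)

Section Birkhoff.
Variables (R : realType) (F : R -> R) (g : R -> R).

Definition birkhoff (n : nat) (x : R) : R := \sum_(k < n) g (iter k F x).

Lemma birkhoffS n x : birkhoff n.+1 x = g x + birkhoff n (F x).
Proof.
by rewrite /birkhoff big_ord_recl; congr (_ + _); apply: eq_bigr => k _; rewrite -iterSr.
Qed.

Lemma birkhoffD m n x : birkhoff (m + n) x = birkhoff m x + birkhoff n (iter m F x).
Proof.
elim: m x => [|m IH] x; first by rewrite /birkhoff big_ord0 add0r.
by rewrite addSn !birkhoffS IH addrA -iterSr.
Qed.
End Birkhoff.

Section Coding.
Variables (R : realType) (I : set nat) (J : nat -> set R) (F0 : R -> R).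
Hypothesis hB : base_map I J F0.
Let U01 : set R := `]0, 1[%classic.
Local Notation R0 := (R0 I J F0).
Local Notation inv_word := (inv_word J F0).
Local Notation follows := (follows J F0).

Lemma R0_step x : R0 x -> R0 (F0 x).
Proof. by move=> Rx n _; rewrite /= -iterSr; exact: Rx. Qed.

Lemma R0_iter n x : R0 x -> R0 (iter n F0 x).
Proof. by move=> Rx; elim: n => //= n IH; exact: R0_step. Qed.

Lemma R0_Delta0 x : R0 x -> Delta0 I J x.
Proof. by move=> /(_ 0%N Logic.I). Qed.

Lemma Delta0_unit x : Delta0 I J x -> U01 x.
Proof. by move=> [i Ii Jx]; exact: (branch_sub hB Ii). Qed.

Lemma R0_unit x : R0 x -> U01 x.
Proof. by move=> /R0_Delta0/Delta0_unit. Qed.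

Lemma R0_pre x : Delta0 I J x -> R0 (F0 x) -> R0 x.
Proof.
by move=> Dx RFx [|n] _ //=; rewrite -iterS iterSr; exact: RFx.
Qed.

Lemma R0_inv_word w y : word I w -> R0 y -> R0 (inv_word w y).
Proof.
elim: w => //= a w IH ww Ry; have Ia : I a by apply: ww; rewrite mem_head.
have Rw := IH (word_behead ww) Ry.
have [Ja e] := inv_branchP hB Ia (R0_unit Rw).
by apply: R0_pre; [exists a|rewrite e].
Qed.

Lemma follows_Delta0 w x k : word I w -> follows w x -> (k < size w)%N ->
  Delta0 I J (iter k F0 x).
Proof.
elim: w x k => [//|a w IH] x [|k] ww [Ja fw] kw.
  by exists a => //; apply: ww; rewrite mem_head.
by rewrite iterSr; apply: IH => //; exact: word_behead ww.
Qed.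

Lemma R0_periodic w x : word I w -> (0 < size w)%N -> follows w x ->
  iter (size w) F0 x = x -> R0 x.
Proof.
move=> ww sw fw ex n _ /=; elim/ltn_ind: n => n IH.
case: (ltnP n (size w)) => nw; first exact: follows_Delta0 ww fw nw.
rewrite -(subnK nw) iterD ex; apply: IH.
by rewrite ltn_subrL sw (leq_trans sw nw).
Qed.

Definition letter (x : R) : nat := xget 0%N [set i | I i /\ J i x].

Lemma letterP x : Delta0 I J x -> I (letter x) /\ J (letter x) x.
Proof.
move=> [i Ii Jx]; rewrite /letter; case: xgetP => [j -> //|/(_ i)[]].
by split.
Qed.

Fixpoint itinerary (n : nat) (x : R) : seq nat :=
  if n is m.+1 then letter x :: itinerary m (F0 x) else [::].

Lemma itineraryP n x : R0 x ->
  [/\ word I (itinerary n x), size (itinerary n x) = n & follows (itinerary n x) x].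
Proof.
elim: n x => [|n IH] x Rx //=; have [ww -> fw] := IH _ (R0_step Rx).
have [Il Jl] := letterP (R0_Delta0 Rx).
by split => //; exact: word_cons.
Qed.

Variables (kappa : R) (kappa1 : 1 < kappa).
Hypothesis kappaP : forall x, Delta0 I J x -> kappa <= `|derive1 F0 x|.
Variables (g : R -> R) (a C0 : R).
Hypotheses (a0 : 0 < a) (holder : forall i, I i ->
  forall x y, (R0 `&` J i) x -> (R0 `&` J i) y -> `|g x - g y| <= C0 * `|x - y| `^ a).
Let r : R := kappa^-1 `^ a.
Local Notation birkhoff := (birkhoff F0 g).

Let kappa0 : 0 < kappa := lt_trans ltr01 kappa1.

Lemma ratio_lt1 : r < 1.
Proof.
rewrite /r /powR gt_eqF ?invr_gt0// expR_lt1 pmulr_rlt0// lnV ?posrE//.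
by rewrite oppr_lt0 ln_gt0.
Qed.

(** After [size w] steps the two orbits are still at distance at most 1, so by expansion [x] and [y]
    are within [kappa ^- size w]. *)
Lemma follows_holder w x y : word I w -> (0 < size w)%N -> follows w x ->
  follows w y -> R0 x -> R0 y -> `|g x - g y| <= `|C0| * r ^+ size w.
Proof.
case: w => // b w ww _ fx fy Rx Ry.
have Ib : I b by apply: ww; rewrite mem_head.
apply: (le_trans (holder Ib (conj Rx fx.1) (conj Ry fy.1))).
apply: (@le_trans _ _ (`|C0| * `|x - y| `^ a)).
  by rewrite ler_wpM2r ?powR_ge0// ler_norm.
rewrite ler_wpM2l// /r -powR_mulrn ?powR_ge0// -powRrM mulrC powRrM.
rewrite powR_mulrn ?invr_ge0 ?(ltW kappa0)//.
apply: ge0_ler_powR; rewrite ?nnegrE ?(ltW a0)// ?exprn_ge0 ?invr_ge0 ?(ltW kappa0)//.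
rewrite exprVn -[leRHS]mul1r ler_pdivlMr ?exprn_gt0// mulrC.
apply: (le_trans (follows_expanding hB kappa1 kappaP ww fx fy)).
have := R0_unit (R0_iter (size (b :: w)) Rx).
have := R0_unit (R0_iter (size (b :: w)) Ry).
rewrite /U01 /= !in_itv /= => /andP[h1 h2] /andP[h3 h4].
by rewrite ler_norml; apply/andP; split; lra.
Qed.

Definition distortion : R := `|C0| / (1 - r).

(** At time [k] the points still share [size w - k] letters, so [follows_holder] bounds the
    differences by a geometric series, uniformly in the length. *)
Lemma bounded_distortion w x y : word I w -> follows w x -> follows w y ->
  R0 x -> R0 y -> `|birkhoff (size w) x - birkhoff (size w) y| <= distortion.
Proof.
move=> ww fx fy Rx Ry.
apply: (@le_trans _ _ (`|C0| * \sum_(k < size w) r ^+ k)); last first.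
  rewrite ler_wpM2l//; apply: geometric_sum_le; first exact: powR_ge0.
  exact: ratio_lt1.
elim: w x y ww fx fy Rx Ry => [|b w IH] x y ww fx fy Rx Ry.
  by rewrite /= /birkhoff !big_ord0 subrr normr0 mulr0.
rewrite big_ord_recr /= !birkhoffS mulrDr.
rewrite (_ : _ - _ = (birkhoff (size w) (F0 x) - birkhoff (size w) (F0 y)) +
   (g x - g y)); last by ring.
apply: (le_trans (ler_normD _ _)); apply: lerD.
  by apply: IH (word_behead ww) fx.2 fy.2 _ _; exact: R0_step.
apply: (le_trans (follows_holder ww _ fx fy Rx Ry)) => //.
rewrite ler_wpM2l//= exprS ler_piMl ?exprn_ge0 ?powR_ge0//.
exact/ltW/ratio_lt1.
Qed.

Variable p : R.
Hypothesis Rp : R0 p.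
Let Up : U01 p := R0_unit Rp.

(** The choice of the base point [p] is immaterial up to constants: by bounded distortion any point
    of the repeller in the cylinder of [w] gives the same weight up to the factor [wconst]. *)
Definition weight (w : seq nat) : R := expR (birkhoff (size w) (inv_word w p)).

Definition wconst : R := expR distortion.

Lemma weight_gt0 w : 0 < weight w. Proof. exact: expR_gt0. Qed.

Lemma wconst_gt0 : 0 < wconst. Proof. exact: expR_gt0. Qed.

Lemma weight_follows w x : word I w -> follows w x -> R0 x ->
  expR (birkhoff (size w) x) <= wconst * weight w /\
  weight w <= wconst * expR (birkhoff (size w) x).
Proof.
move=> ww fx Rx; have := bounded_distortion ww fx
  (follows_inv_word hB ww Up) Rx (R0_inv_word ww Rp).
rewrite ler_norml => /andP[h1 h2]; rewrite /wconst /weight -!expRD !ler_expR.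
by split; lra.
Qed.

(** The Birkhoff sum splits after [size u] steps; only the part along [u] is read at a point other
    than the one defining [weight u], which costs [wconst]. *)
Lemma weight_cat u v : word I u -> word I v ->
  weight u * weight v <= wconst * weight (u ++ v) /\
  weight (u ++ v) <= wconst * (weight u * weight v).
Proof.
move=> wu wv; have Uv := inv_word_unit hB wv Up.
have [h1 h2] := weight_follows wu (follows_inv_word hB wu Uv)
  (R0_inv_word wu (R0_inv_word wv Rp)).
have e : weight (u ++ v) =
    expR (birkhoff (size u) (inv_word u (inv_word v p))) * weight v.
  by rewrite /weight size_cat birkhoffD inv_word_cat (iter_inv_word hB)// expRD.
by rewrite e !mulrA !ler_pM2r ?weight_gt0.
Qed.

Lemma weight_rot m w : word I w -> weight w <= wconst ^+ 2 * weight (rot m w).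
Proof.
move=> ww; have [wd wt] : word I (drop m w) /\ word I (take m w).
  by split=> b bw; apply: ww; [exact: mem_drop bw|exact: mem_take bw].
have [_ h1] := weight_cat wt wd; have [h2 _] := weight_cat wd wt.
rewrite cat_take_drop in h1; apply: (le_trans h1).
by rewrite expr2 -mulrA ler_pM2l ?wconst_gt0// mulrC.
Qed.
End Coding.

(** * The skew product *)

Section FracTranslate.
Variable R : realType.
Implicit Type x : R.

Lemma floor_unitD x (l : nat) : 0 < x < 1 -> Num.floor (x + l%:R) = l%:Z.
Proof.
move=> /andP[x0 x1]; apply: floor_def; rewrite intrD -!pmulrn.
by apply/andP; split; lra.
Qed.

Lemma frac_unitD x (l : nat) : 0 < x < 1 -> frac (x + l%:R) = x.
Proof. by move=> x01; rewrite /frac floor_unitD// -pmulrn addrK. Qed.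

Lemma unitD_inj x y (l m : nat) : 0 < x < 1 -> 0 < y < 1 ->
  x + l%:R = y + m%:R -> x = y /\ l = m.
Proof.
move=> x01 y01 e; split; first by rewrite -(frac_unitD l x01) e frac_unitD.
by apply/eqP; rewrite -eqz_nat -(floor_unitD l x01) e floor_unitD.
Qed.
End FracTranslate.

Section SkewProduct.
Variables (R : realType) (I : set nat) (J : nat -> set R).
Variables (F0 : R -> R) (psi : R -> int) (psi1 : R -> nat).
Hypotheses (hB : base_map I J F0) (hS : step_length I J psi).
Hypothesis hR : reflexion_rule I J psi psi1.
Local Notation R0 := (R0 I J F0).
Local Notation D0 := (Delta0 I J).
Local Notation follows := (follows J F0).
Local Notation FN := (FN F0 psi psi1).

Lemma Delta0_01 x : D0 x -> 0 < x < 1.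
Proof. by move=> /(Delta0_unit hB); rewrite /= in_itv. Qed.

Lemma F0_01 x : D0 x -> 0 < F0 x < 1.
Proof.
move=> [i Ii Jx]; have : (F0 @` J i) (F0 x) by exists x.
by rewrite (base_full hB Ii) /= in_itv.
Qed.

Lemma psi_ge x : D0 x -> -1 <= psi x.
Proof.
move=> Dx; rewrite -(ler_int R) mulrN1z -lee_fin -(step_inf hS).
by apply: ereal_inf_lbound; exists x.
Qed.

Lemma psi_le_psi1 x : D0 x -> psi x <= (psi1 x)%:Z.
Proof. by have [M _ MP] := refl_bound hR => /MP/andP[]. Qed.

(** The values are integers not below -1, so a negative one equals -1. *)
Lemma psi_attains : exists2 x, D0 x & psi x = -1.
Proof.
have : (ereal_inf [set ((psi x)%:~R : R)%:E | x in D0] < 0)%E.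
  by rewrite (step_inf hS) lte_fin oppr_lt0.
move=> /ereal_inf_lt[_ [x Dx <-]]; rewrite lte_fin ltrz0 => px.
by exists x => //; have := psi_ge Dx; lia.
Qed.

Definition step_of (a : nat) : int := psi (xget 0 (J a)).
Definition step1_of (a : nat) : nat := psi1 (xget 0 (J a)).

Lemma xget_branch a : I a -> J a (xget 0 (J a)).
Proof. by move=> /(base_itv hB)[[x Jx] _ _ _]; case: xgetP => // /(_ x). Qed.

Lemma psi_branch a x : I a -> J a x -> psi x = step_of a.
Proof. by move=> Ia Jx; apply: (step_cst hS Ia) => //; exact: xget_branch. Qed.

Lemma psi1_branch a x : I a -> J a x -> psi1 x = step1_of a.
Proof. by move=> Ia Jx; apply: (refl_cst hR Ia) => //; exact: xget_branch. Qed.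

Lemma FN_translate x (l : nat) : D0 x ->
  FN (x + l%:R) = F0 x + (reflect_step (psi x) (psi1 x) l)%:R.
Proof.
move=> Dx; have x01 := Delta0_01 Dx; have /andP[x0 x1] := x01.
rewrite /Defs.FN; case: (posnP l) => [->|l0]; first by rewrite addr0 x1.
have -> : (x + l%:R < 1) = false.
  by apply/negbTE; rewrite -leNgt (le_trans _ (ler_wpDl (ltW x0) (lexx _)))// ler1n.
rewrite /FZ frac_unitD// floor_unitD// -addrA; congr (_ + _).
by rewrite -intrD [RHS]pmulrn addrC -(reflect_step_pos (psi1 x) (psi_ge Dx) l0).
Qed.

(** This is the integer part of the [FN]-orbit of [x + l], computed along the [F0]-orbit of [x]. *)
Fixpoint level (n : nat) (x : R) (l : nat) : nat :=
  if n is m.+1 then level m (F0 x) (reflect_step (psi x) (psi1 x) l) else l.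

Lemma iter_FN n x (l : nat) : (forall k, (k < n)%N -> D0 (iter k F0 x)) ->
  iter n FN (x + l%:R) = iter n F0 x + (level n x l)%:R.
Proof.
elim: n x l => // n IH x l Dx; rewrite !iterSr FN_translate ?IH//.
  by move=> k kn; rewrite -iterSr; exact: Dx.
exact: (Dx 0%N).
Qed.

Lemma level_walk w x l : word I w -> follows w x ->
  level (size w) x l = walk step_of step1_of w l.
Proof.
elim: w x l => //= a w IH x l ww [Ja fw].
have Ia : I a by apply: ww; rewrite mem_head.
by rewrite IH ?(psi_branch Ia Ja) ?(psi1_branch Ia Ja)//; exact: word_behead ww.
Qed.

(** Reflexion only raises the walk, because [psi <= psi1]. *)
Lemma level_ge n x (l : nat) : R0 x ->
  l%:Z + \sum_(k < n) psi (iter k F0 x) <= (level n x l)%:Z.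
Proof.
elim: n x l => [|n IH] x l Rx; first by rewrite big_ord0 addr0.
rewrite big_ord_recl /=; apply: le_trans (IH _ _ (R0_step Rx)).
under eq_bigr => k _ do rewrite -iterS iterSr.
have Dx := R0_Delta0 Rx.
rewrite addrA lerD2r; apply: reflect_step_ge; first exact: psi_ge.
exact: psi_le_psi1.
Qed.

Lemma psi_sum_follows w x : word I w -> follows w x ->
  \sum_(k < size w) psi (iter k F0 x) = wsum step_of w.
Proof.
elim: w x => [|a w IH] x ww; first by rewrite big_ord0 wsum_nil.
move=> [Ja fw]; have Ia : I a by apply: ww; rewrite mem_head.
rewrite /= big_ord_recl /= wsum_cons -(IH _ (word_behead ww) fw).
rewrite (psi_branch Ia Ja); congr (_ + _).
by apply: eq_bigr => k _; rewrite -iterS iterSr.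
Qed.

Lemma DeltaN_translate x (l : nat) : 0 < x < 1 ->
  DeltaN I J (x + l%:R) <-> D0 x.
Proof.
move=> x01; split=> [[y Dy [m _ e]]|Dx]; last by exists x => //; exists l.
by have [<- _] := unitD_inj (Delta0_01 Dy) x01 e.
Qed.

Lemma repeller_FN x (l : nat) : 0 < x < 1 ->
  repeller (DeltaN I J) FN (x + l%:R) <-> R0 x.
Proof.
move=> x01; split=> [|Rx n _ /=]; last first.
  have Dn k : D0 (iter k F0 x) by apply: R0_Delta0; exact: R0_iter.
  by rewrite iter_FN//; apply/DeltaN_translate => //; exact: Delta0_01.
move=> H n _ /=; elim: n x l x01 H => [|n IH] x l x01 H.
  by apply/(DeltaN_translate l x01); exact: (H 0%N).
have Dx : D0 x by apply/(DeltaN_translate l x01); exact: (H 0%N).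
rewrite iterSr.
apply: (IH _ (reflect_step (psi x) (psi1 x) l) (F0_01 Dx)).
by rewrite -FN_translate// => m _ /=; rewrite -iterSr; exact: H.
Qed.

Lemma Per_FN n x (l : nat) : 0 < x < 1 ->
  Per (DeltaN I J) FN n (x + l%:R) <-> Per D0 F0 n x /\ level n x l = l.
Proof.
move=> x01; have Dn : R0 x -> forall k, D0 (iter k F0 x).
  by move=> Rx k; apply: R0_Delta0; exact: R0_iter.
split=> [[/repeller_FN-/(_ x01) Rx]|[[Rx e] lx]].
  rewrite iter_FN; last by move=> k _; exact: Dn.
  by move=> /(unitD_inj (Delta0_01 (Dn Rx n)) x01)[].
split; first exact/repeller_FN.
by rewrite iter_FN ?e ?lx// => k _; exact: Dn.
Qed.

Lemma birkhoff_FN (g : R -> R) n x (l : nat) : R0 x ->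
  \sum_(k < n) g (frac (iter k FN (x + l%:R))) = birkhoff F0 g n x.
Proof.
move=> Rx; have Dn k : D0 (iter k F0 x) by apply: R0_Delta0; exact: R0_iter.
by apply: eq_bigr => k _; rewrite iter_FN// frac_unitD//; exact: Delta0_01.
Qed.

(** Transitivity moves some point of the unit interval into []h, h + 1[]; the itinerary of that
    point drives the walk from 0 to [h]. *)
Lemma transitive_path p (h : nat) : R0 p -> top_transitive (DeltaN I J) FN ->
  exists2 u, word I u & walk step_of step1_of u 0 = h.
Proof.
move=> Rp tr; have p01 := Delta0_01 (R0_Delta0 Rp).
have [||||n [_ [[x [Ux rx] <-] [Vx _]]]] :=
  tr `]0, 1[%classic `]h%:R, h.+1%:R[%classic.
- exact: interval_open.
- exact: interval_open.
- exists p; split; first by rewrite /= in_itv.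
  by have := (repeller_FN 0 p01).2 Rp; rewrite mulr0n addr0.
- exists (p + h%:R); split; last exact/repeller_FN.
  by rewrite /= in_itv /= -natr1; have /andP[? ?] := p01; apply/andP; split; lra.
have x01 : 0 < x < 1 by move: Ux; rewrite /= in_itv.
have Rx : R0 x by apply: (repeller_FN 0 x01).1; rewrite mulr0n addr0.
have Dn k : D0 (iter k F0 x) by apply: R0_Delta0; exact: R0_iter.
have [wu su fu] := itineraryP n Rx.
exists (itinerary I J F0 n x) => //.
rewrite -(level_walk 0 wu fu) su.
have := @iter_FN n x 0 (fun k _ => Dn k); rewrite mulr0n addr0 => ex.
move: Vx; rewrite ex /= in_itv /=.
move/andP: (Delta0_01 (Dn n)) => [y0 y1] /andP[h1 h2].
set L := level _ _ _ in h1 h2 *.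
have a1 : (h < L.+1)%N by rewrite -(ltr_nat R) -natr1; lra.
have a2 : (L < h.+1)%N by rewrite -(ltr_nat R); lra.
by apply/eqP; rewrite eqn_leq -ltnS a2 -ltnS a1.
Qed.
End SkewProduct.

(** * Comparison of the pressures *)

(** Pressures may be infinite; this reduces their comparison to real rates [c]. *)
Lemma lee_of_real_gt (R : realType) (x y : \bar R) :
  (forall c : R, (y < c%:E)%E -> (x <= c%:E)%E) -> (x <= y)%E.
Proof.
case: y => [r| |] H; last 2 first.
- exact: leey.
- by rewrite leeNy_eq; apply/eqP/eq_ninfty => c; apply: H; exact: ltNyr.
by apply/lee_addgt0Pr => e e0; rewrite -EFinD; apply: H; rewrite lte_fin ltrDl.
Qed.

Section Comparison.
Variables (R : realType) (I : set nat) (J : nat -> set R).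
Variables (F0 : R -> R) (psi : R -> int) (psi1 : R -> nat).
Hypotheses (hB : base_map I J F0) (hS : step_length I J psi).
Hypothesis hR : reflexion_rule I J psi psi1.
Local Notation R0 := (R0 I J F0).
Local Notation D0 := (Delta0 I J).
Local Notation follows := (follows J F0).
Local Notation FN := (FN F0 psi psi1).
Local Notation inv_word := (inv_word J F0).
Variables (kappa : R) (kappa1 : 1 < kappa).
Hypothesis kappaP : forall x, D0 x -> kappa <= `|derive1 F0 x|.
Variables (g : R -> R) (a C0 : R).
Hypotheses (a0 : 0 < a) (holder : forall i, I i ->
  forall x y, (R0 `&` J i) x -> (R0 `&` J i) y -> `|g x - g y| <= C0 * `|x - y| `^ a).
Variables (v : seq nat) (alpha beta : R).
Hypotheses (wv : word I v) (v0 : (0 < size v)%N) (alpha0 : 0 < alpha) (beta1 : beta < 1).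
Hypothesis vP : forall y, `]0, 1[%classic y -> alpha <= inv_word v y <= beta.
Variable p : R.
Hypothesis Rp : R0 p.

Local Notation W := (weight J F0 g p).
Local Notation C := (wconst kappa a C0).
Local Notation st := (step_of J psi).
Local Notation st1 := (step1_of J psi1).
Local Notation S := (wsum st).
Local Notation walk := (walk st st1).

Let C_gt0 : 0 < C := wconst_gt0 kappa a C0.
Let W_gt0 w : 0 < W w := weight_gt0 J F0 g p w.

Definition tilted (q : R) (x : R) : R := g x + q * (psi x)%:~R.
Definition tweight (q : R) (w : seq nat) : R := W w * expR (q * (S w)%:~R).

Lemma birkhoff_tilted q w x : word I w -> follows w x ->
  birkhoff F0 (tilted q) (size w) x =
  birkhoff F0 g (size w) x + q * (S w)%:~R.
Proof.
move=> ww fw; rewrite -(psi_sum_follows hB hS ww fw) /birkhoff big_split /=.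
by rewrite -mulr_sumr rmorph_sum.
Qed.

(** Periodic points are sent to their itineraries, injectively by expansion, and bounded distortion
    compares the weights. *)
Lemma points_le_words q n (Y : seq R) : (0 < n)%N -> uniq Y ->
  (forall y, y \in Y -> Per D0 F0 n y) ->
  exists X, [/\ uniq X, (forall w, w \in X -> word I w /\ size w = n) &
    \sum_(y <- Y) expR (birkhoff F0 (tilted q) n y)
      <= C * \sum_(w <- X) tweight q w].
Proof.
move=> n0 uY YP; exists [seq itinerary I J F0 n y | y <- Y]; split.
- rewrite map_inj_in_uniq// => x y /YP[Rx ex] /YP[Ry ey] e.
  have [ww sw fx] := itineraryP n Rx; have [_ _ fy] := itineraryP n Ry.
  rewrite -e in fy.
  by apply: (follows_periodic_inj hB kappa1 kappaP ww _ fx fy); rewrite sw.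
- by move=> w /mapP[y /YP[Ry _] ->]; have [] := itineraryP n Ry.
rewrite big_map mulr_sumr big_seq [leRHS]big_seq; apply: ler_sum => y /YP[Ry _].
have [ww sw fy] := itineraryP n Ry.
have [h _] := weight_follows hB kappa1 kappaP a0 holder Rp ww fy Ry.
rewrite -{1}sw birkhoff_tilted// expRD mulrA ler_pM2r ?expR_gt0//.
Qed.

Definition periodic_point (w : seq nat) : R :=
  xget 0 [set x | `]0, 1[%classic x /\ inv_word w x = x].

Lemma periodic_pointP u w (z := u ++ v ++ w) : word I u -> word I w ->
  [/\ follows z (periodic_point z), R0 (periodic_point z)
    & iter (size z) F0 (periodic_point z) = periodic_point z].
Proof.
move=> wu ww; have wz : word I z by apply: word_cat => //; exact: word_cat.
have [Ux ex] : `]0, 1[%classic (periodic_point z) /\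
    inv_word z (periodic_point z) = periodic_point z.
  have [x Ux ex] := fixed_point_exists hB kappa1 kappaP wv alpha0 beta1 vP wu ww.
  by rewrite {1 3}/periodic_point; case: xgetP => [y -> //|/(_ x)[]].
have fz : follows z (periodic_point z).
  by rewrite -ex; exact: (follows_inv_word hB).
have e : iter (size z) F0 (periodic_point z) = periodic_point z.
  by rewrite -{1}ex; exact: (iter_inv_word hB).
split => //; apply: (R0_periodic wz _ fz e).
by rewrite !size_cat addn_gt0 addn_gt0 v0 orbT.
Qed.

(** A word [w] is sent to the periodic point of [j :: v ++ w]: the letter [j] places it in [J j],
    and [v] guarantees that it exists. The period grows only by the fixed length of [u]. *)
Lemma words_le_points q j (c : R) : I j ->
  (pressure I J F0 j (tilted q) < c%:E)%E ->
  exists K n0, forall n X, (n0 <= n)%N -> uniq X ->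
  (forall w, w \in X -> word I w /\ size w = n) ->
  \sum_(w <- X) tweight q w <= K * expR (c * n%:R).
Proof.
move=> Ij /limsup_growth_lt[n0 n0P].
pose u := [:: j] ++ v.
have wj : word I [:: j] by move=> b; rewrite inE => /eqP->.
have wu : word I u by exact: word_cat.
(* One factor [C] comes from splitting [u ++ w], the other from distortion; the rest removes the
   tilted weight of [u]. *)
pose K1 := C ^+ 2 / W u * expR (- (q * (S u)%:~R)).
have K1_gt0 : 0 < K1 by rewrite mulr_gt0 ?expR_gt0 ?divr_gt0 ?exprn_gt0.
exists (K1 * expR (c * (size u)%:R)), n0 => n X n0n uX XP.
pose pt w := periodic_point ([:: j] ++ v ++ w).
have ptP w : w \in X -> [/\ follows (u ++ w) (pt w), R0 (pt w)
    & iter (size u + n)%N F0 (pt w) = pt w].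
  move=> /XP[ww sw]; have [h1 h2 h3] := periodic_pointP wj ww.
  rewrite /u -catA; split=> //.
  by move: h3; rewrite catA size_cat sw.
have step w : w \in X ->
    tweight q w <= K1 * expR (birkhoff F0 (tilted q) (size u + n) (pt w)).
  move=> wX; have [fw Rw _] := ptP w wX; have [ww sw] := XP w wX.
  have wuw : word I (u ++ w) by exact: word_cat.
  have [_ h1] := weight_follows hB kappa1 kappaP a0 holder Rp wuw fw Rw.
  have [h2 _] := weight_cat hB kappa1 kappaP a0 holder Rp wu ww.
  have -> : (size u + n = size (u ++ w))%N by rewrite size_cat sw.
  rewrite birkhoff_tilted// wsum_cat intrD mulrDr !expRD /tweight /K1 expRN.
  set B := expR (birkhoff _ _ _ _) in h1 *.
  rewrite (_ : _ / _ * _ * _ = C ^+ 2 / W u * B * expR (q * (S w)%:~R)); last first.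
    by field; rewrite !gt_eqF ?expR_gt0.
  rewrite ler_pM2r ?expR_gt0// mulrAC ler_pdivlMr// mulrC.
  by apply: (le_trans h2); rewrite expr2 -mulrA ler_pM2l.
rewrite big_seq; apply: (le_trans (ler_sum _ step)); rewrite -big_seq -mulr_sumr.
rewrite -mulrA ler_pM2l// -expRD -mulrDr -natrD -lee_fin.
apply: le_trans (n0P (size u + n)%N _); last exact: leq_trans (leq_addl _ _).
rewrite -(big_map pt xpredT (fun x => expR (birkhoff F0 (tilted q) (size u + n) x))).
apply: (@seq_le_esum _ _ _ (fun x => expR (birkhoff F0 (tilted q) (size u + n) x))).
  rewrite map_inj_in_uniq// => w w' wX wX' e.
  have [fw _ _] := ptP w wX; have [fw' _ _] := ptP w' wX'.
  have [ww sw] := XP w wX; have [ww' sw'] := XP w' wX'.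
  rewrite -e in fw'.
  have := follows_inj hB (word_cat wu ww) (word_cat wu ww') _ fw fw'.
  rewrite !size_cat sw sw' => /(_ erefl)/eqP.
  by rewrite eqseq_cat// => /andP[_ /eqP].
move=> x /mapP[w wX ->]; have [fw Rw ew] := ptP w wX; split; first by split.
by case: fw.
Qed.

(** A periodic point at level [h] returns to [h], so its [psi]-sum is nonpositive and the tilt by
    [q <= 0] does not lower its weight. Passing through words permits different branches [i] and
    [j]. *)
Lemma pressureN_le q i j (h : nat) : I i -> I j -> q <= 0 ->
  (pressureN I J F0 psi psi1 i h g <= pressure I J F0 j (tilted q))%E.
Proof.
move=> Ii Ij q0; apply: lee_of_real_gt => c /(words_le_points Ij)[K [n0 KP]].
apply: (@limsup_growth_le _ _ (C * K) _ (maxn n0 1)) => n.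
rewrite geq_max => /andP[n0n n_gt0].
apply: esum_le_seq => Y uY YP.
have {}YP y : y \in Y -> [/\ y = frac y + h%:R, Per D0 F0 n (frac y) &
    level F0 psi psi1 n (frac y) h = h].
  move=> /YP[Py [x Jx exy]]; have x01 : 0 < x < 1.
    by apply: (Delta0_01 hB); exists i.
  by rewrite -exy frac_unitD//; move: Py; rewrite -exy => /(Per_FN psi1 hB hS n h x01)[].
have [||X [uX XP XY]] := @points_le_words q n [seq frac y | y <- Y] n_gt0.
- rewrite map_inj_in_uniq// => x y /YP[ex _ _] /YP[ey _ _] e.
  by rewrite ex ey e.
- by move=> _ /mapP[y /YP[_ Py _] ->].
rewrite lee_fin -mulrA; apply: le_trans (ler_wpM2l (ltW C_gt0) (KP n X n0n uX XP)).
apply: le_trans XY; rewrite big_map big_seq [leRHS]big_seq.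
apply: ler_sum => y /YP[ey [Ry _] ly].
rewrite ler_expR {1}ey (birkhoff_FN psi1 hB hS)//.
have [ww sw fy] := itineraryP n Ry.
rewrite -{2}sw birkhoff_tilted// sw lerDl -(psi_sum_follows hB hS ww fy) sw.
have := level_ge hS hR n h Ry; rewrite ly gerDl => le0.
by rewrite mulr_le0 ?lerz0.
Qed.

(** * Closing words into periodic orbits of the reflected map *)

Variables (i0 i h : nat) (u : seq nat).
Hypotheses (Ii0 : I i0) (s_i0 : st i0 = -1) (Ii : I i).
Hypotheses (wu : word I u) (walk_u : walk u 0 = h).

Let s_ge b : I b -> -1 <= st b.
Proof. by move=> Ib; apply: (psi_ge hS); exists b => //; exact: (xget_branch hB). Qed.

Let head : seq nat := i :: nseq (walk [:: i] h) i0.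
Let mid : seq nat := nseq (walk v 0) i0.

(** From level [h], [head] starts in [J i] and descends to 0, [mid] undoes the rise caused by [v],
    [z] is meant to lead from 0 to [l], the copies of [i0] return to 0, and [u] climbs back to
    [h]. *)
Definition loop (l : nat) (z : seq nat) : seq nat :=
  head ++ v ++ mid ++ z ++ nseq l i0 ++ u.

Let whead : word I head.
Proof. by apply: word_cons => //; exact: word_nseq. Qed.

Let wmid : word I mid. Proof. exact: word_nseq. Qed.

Let wpost l : word I (nseq l i0 ++ u).
Proof. by apply: word_cat => //; exact: word_nseq. Qed.

Let wtail l z : word I z -> word I (mid ++ z ++ nseq l i0 ++ u).
Proof. by move=> wz; apply: word_cat => //; exact: word_cat. Qed.

Lemma word_loop l z : word I z -> word I (loop l z).
Proof. by move=> wz; do 2!apply: word_cat => //; exact: wtail. Qed.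

Lemma walk_loop z : walk (loop (walk z 0) z) h = h.
Proof.
rewrite /loop /head -cat1s -!catA !walk_cat.
by do 3!rewrite walk_descent//.
Qed.

Lemma loop_inj l z z' : size z = size z' -> loop l z = loop l z' -> z = z'.
Proof.
move=> sz; rewrite /loop => /eqP; do 3!rewrite eqseq_cat// eqxx /=.
by rewrite eqseq_cat// => /andP[/eqP].
Qed.

Let pre : seq nat := head ++ v ++ mid.

Lemma weight_loop l z : word I z ->
  W z <= C ^+ 2 / (W pre * W (nseq l i0 ++ u)) * W (loop l z).
Proof.
move=> wz; have wpre : word I pre by do 2!apply: word_cat => //.
have [h1 _] := weight_cat hB kappa1 kappaP a0 holder Rp wz (@wpost l).
have [h2 _] := weight_cat hB kappa1 kappaP a0 holder Rp wpre (word_cat wz (@wpost l)).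
rewrite /loop (catA v) (catA head) -/pre.
rewrite mulrAC ler_pdivlMr ?mulr_gt0//.
rewrite mulrCA; apply: (le_trans (ler_wpM2l (ltW (W_gt0 pre)) h1)).
by rewrite mulrCA expr2 -mulrA ler_pM2l.
Qed.

Definition loop_point (l : nat) (z : seq nat) : R :=
  periodic_point (loop l z) + h%:R.

Lemma loop_pointP l z (N := size (loop l z)) : word I z -> walk z 0 = l ->
  [/\ follows (loop l z) (periodic_point (loop l z)),
      R0 (periodic_point (loop l z)),
      Per (DeltaN I J) FN N (loop_point l z) &
      [set x + h%:R | x in J i] (loop_point l z)].
Proof.
move=> wz wl; have [f Rl e] := periodic_pointP whead (@wtail l z wz).
have x01 := Delta0_01 hB (R0_Delta0 Rl).
split => //; last by exists (periodic_point (loop l z)) => //; case: f.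
apply/(Per_FN psi1 hB hS _ _ x01); split; first by split.
by rewrite (level_walk hB hS hR h (@word_loop l z wz) f) -{1}wl walk_loop.
Qed.

Variables (c : R) (n0 : nat).
Hypothesis rate : forall n, (n0 <= n)%N ->
  (\esum_(x in Per (DeltaN I J) FN n `&` [set (x + h%:R)%R | x in J i])
     (expR (\sum_(k < n) g (frac (iter k FN x))))%:E <= (expR (c * n%:R))%:E)%E.

Let loopc (l : nat) : R :=
  C / (W pre * W (nseq l i0 ++ u)) * C ^+ 2 * expR (c * (size pre + l + size u)%:R).

(** The loops through the words of [Z] have a common length and give distinct periodic points of
    [FN] at level [h]. Their total weight is bounded by [rate], and the cost of closing does not
    depend on [n]. *)
Lemma excursions_le n l (Z : seq (seq nat)) : (n0 <= n)%N -> uniq Z ->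
  (forall z, z \in Z -> [/\ word I z, size z = n & walk z 0 = l]) ->
  \sum_(z <- Z) W z <= loopc l * expR (c * n%:R).
Proof.
move=> n0n uZ ZP; pose N := (size pre + n + l + size u)%N.
have sN z : z \in Z -> size (loop l z) = N.
  by move=> /ZP[_ sz _]; rewrite /loop /N /pre !size_cat size_nseq sz; lia.
pose Q := C / (W pre * W (nseq l i0 ++ u)) * C ^+ 2.
have Q_gt0 : 0 < Q by rewrite mulr_gt0 ?exprn_gt0// divr_gt0 ?mulr_gt0.
rewrite /loopc -/Q -mulrA -expRD -mulrDr -natrD.
have -> : (size pre + l + size u + n = N)%N by rewrite /N; lia.
pose B z := expR (\sum_(k < N) g (frac (iter k FN (loop_point l z)))).
apply: (@le_trans _ _ (Q * \sum_(z <- Z) B z)).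
  rewrite mulr_sumr big_seq [leRHS]big_seq; apply: ler_sum => z zZ.
  have [wz _ wl] := ZP z zZ; have [f Rz _ _] := loop_pointP wz wl.
  rewrite /B (birkhoff_FN psi1 hB hS)// -(sN z zZ).
  have [_ h1] := weight_follows hB kappa1 kappaP a0 holder Rp (@word_loop l z wz) f Rz.
  apply: (le_trans (weight_loop l wz)).
  rewrite (_ : Q = C ^+ 2 / (W pre * W (nseq l i0 ++ u)) * C); last by rewrite /Q; ring.
  by rewrite -[leRHS]mulrA ler_pM2l// divr_gt0 ?mulr_gt0 ?exprn_gt0.
rewrite ler_pM2l// -lee_fin; apply: le_trans (@rate N _); last first.
  by apply: (leq_trans n0n); rewrite /N; lia.
rewrite /B -(big_map (loop_point l) xpredT
  (fun x => expR (\sum_(k < N) g (frac (iter k FN x))))).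
apply: (@seq_le_esum _ _ _ (fun x => expR (\sum_(k < N) g (frac (iter k FN x))))).
  rewrite map_inj_in_uniq// => z z' zZ zZ' e.
  have [wz sz wl] := ZP z zZ; have [f _ _ _] := loop_pointP wz wl.
  have [wz' sz' wl'] := ZP z' zZ'; have [f' _ _ _] := loop_pointP wz' wl'.
  apply: (@loop_inj l); first by rewrite sz sz'.
  apply: (follows_inj hB (@word_loop l z wz) (@word_loop l z' wz') _ f).
    by rewrite !sN.
  by move/addIr : e => ->.
move=> x /mapP[z zZ ->]; have [wz sz wl] := ZP z zZ.
by have [_ _ Pz Jz] := loop_pointP wz wl; rewrite sN// in Pz.
Qed.

(** Each word is rotated so that its suffix sums are nonpositive; the walk from 0 then ends at a
    level at most [M]. The [n.+1] rotation indices cost [eps] in the rate, the boundedly many levels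
    only a constant. *)
Lemma nonpositive_words_le (eps : R) : 0 < eps -> exists K, forall n X,
  (n0 <= n)%N -> uniq X ->
  (forall w, w \in X -> [/\ word I w, size w = n & S w <= 0]) ->
  \sum_(w <- X) W w <= K * expR ((c + eps) * n%:R).
Proof.
move=> eps0; have [M M0 MP] := refl_bound hR.
have s1_le b : I b -> (st1 b)%:Z <= st b + M.
  move=> Ib; have /MP/andP[] // : D0 (xget 0 (J b)).
  by exists b => //; exact: (xget_branch hB).
pose L := `|M|%N.
pose B := \sum_(l < L.+1) loopc l.
exists (C ^+ 2 * B * (1 + eps^-1)) => n X n0n uX XP.
pose ri (w : seq nat) := xget 0%N [set m | (m <= size w)%N /\
  forall k, S (drop k (rot m w)) <= 0].
have riP w : w \in X -> (ri w <= n)%N /\ forall k, S (drop k (rot (ri w) w)) <= 0.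
  move=> /XP[ww sw Sw]; have [m m1 m2] := rot_nonpositive_suffixes Sw.
  by rewrite -sw /ri; case: xgetP => [y -> //|/(_ m)[]].
pose lv w := walk (rot (ri w) w) 0.
have lvP w : w \in X -> (lv w < L.+1)%N.
  move=> wX; have [ww _ _] := XP w wX; have [_ hs] := riP w wX.
  have := walk_le s_ge s1_le 0 (@word_rot _ _ (ri w) _ ww) hs.
  have := hs 0%N; rewrite drop0 add0r -/(lv w) => h0 hl.
  rewrite ltnS -lez_nat /L gtz0_abs//; apply: (le_trans hl).
  by rewrite ge_max lexx andbT (le_trans h0)// ltW.
(* Once the rotation index and the end level are fixed, the rotation is injective and
   [excursions_le] applies. *)
pose ix w : 'I_n.+1 * 'I_L.+1 := (inord (ri w), inord (lv w)).
rewrite (partition_big ix xpredT)//=.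
have step ml : \sum_(w <- X | ix w == ml) W w <=
    C ^+ 2 * (loopc ml.2 * expR (c * n%:R)).
  case: ml => m l /=; pose Y := [seq w <- X | ix w == (m, l)].
  have YP w : w \in Y -> [/\ w \in X, ri w = m & lv w = l].
    rewrite mem_filter => /andP[/eqP[em el] wX]; split => //.
      by rewrite -em inordK// ltnS; have [] := riP w wX.
    by rewrite -el inordK//; exact: lvP.
  rewrite -big_filter -/Y.
  apply: (@le_trans _ _ (C ^+ 2 * \sum_(z <- [seq rot m w | w <- Y]) W z)).
    rewrite big_map mulr_sumr big_seq [leRHS]big_seq; apply: ler_sum => w /YP[wX _ _].
    have [ww _ _] := XP w wX.
    exact: (weight_rot hB kappa1 kappaP a0 holder Rp).
  rewrite ler_pM2l ?exprn_gt0//; apply: excursions_le => //.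
    by rewrite map_inj_uniq ?filter_uniq//; exact: rot_inj.
  move=> z /mapP[w /YP[wX em el] ->]; have [ww sw _] := XP w wX.
  by rewrite size_rot -em; split => //; exact: word_rot.
apply: (le_trans (ler_sum _ (fun ml _ => step ml))).
rewrite -(pair_bigA _ (fun (m : 'I_n.+1) (l : 'I_L.+1) =>
  C ^+ 2 * (loopc l * expR (c * n%:R)))) /=.
rewrite sumr_const card_ord -[leLHS]mulr_natl -mulr_sumr -mulr_suml -/B.
have B0 : 0 <= B.
  apply: sumr_ge0 => l _; rewrite mulr_ge0 ?expR_ge0// mulr_ge0 ?exprn_ge0 ?(ltW C_gt0)//.
  by rewrite divr_ge0 ?mulr_ge0 ?(ltW C_gt0)// ltW.
rewrite [(c + eps) * _]mulrDl expRD.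
rewrite [leRHS](_ : _ = ((1 + eps^-1) * expR (eps * n%:R)) *
   (C ^+ 2 * (B * expR (c * n%:R)))); last by ring.
rewrite ler_wpM2r ?natr_expR_bound// !mulr_ge0 ?exprn_ge0 ?expR_ge0 ?(ltW C_gt0)//.
Qed.

(** One [eps] absorbs the number of rotations; the other is lost in the duality, applied at the rate
    [c + eps]. *)
Lemma tilted_pressure_le j (eps : R) : I j -> 0 < eps -> exists2 q, q <= 0 &
  (pressure I J F0 j (tilted q) <= (c + eps + eps)%:E)%E.
Proof.
move=> Ij eps0; have [K KP] := nonpositive_words_le eps0.
have Wcat w w' : word I w -> word I w' -> W w * W w' <= C * W (w ++ w').
  by move=> ww ww'; have [] := weight_cat hB kappa1 kappaP a0 holder Rp ww ww'.
have [q [K' [q0 qP]]] := one_sided_duality W_gt0 C_gt0 Wcat s_ge Ii0 s_i0 KP eps0.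
exists q => //; apply: (@limsup_growth_le _ _ (C * K') _ 1) => n n_gt0.
apply: esum_le_seq => Y uY YP.
have [|X [uX XP XY]] := @points_le_words q n Y n_gt0 uY.
  by move=> y /YP[].
rewrite lee_fin; apply: (le_trans XY).
by rewrite -mulrA ler_pM2l//; exact: qP.
Qed.
End Comparison.

Theorem theorem4p13 (R : realType) (I : set nat) (J : nat -> set R)
    (F0 : R -> R) (psi : R -> int) (psi1 : R -> nat) (g : R -> R)
    (hF : skew_periodic_reflective I J F0 psi psi1)
    (g_neg : forall x, R0 I J F0 x -> g x < 0)
    (g_holder : holder_on_branches I J F0 g)
    (i j h : nat) (Ii : I i) (Ij : I j) :
  pressureN I J F0 psi psi1 i h g =
  ereal_inf [set pressure I J F0 j (fun x => g x + q * (psi x)%:~R)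
            | q in [set q : R | q <= 0]].
Proof.
have [hB hS hR _ trN] := hF.
have [a [C0 [a0 _ holder]]] := g_holder.
have [kappa kappa1 kappaP] := expansion_constant hB.
have [v [alpha [beta [wv v0 alpha0 beta1 vP]]]] := interior_word hB kappa1 kappaP.
(* With empty outer words this is the periodic point of [v], which serves as base point of the
   weights. *)
have [_ Rp _] := periodic_pointP hB kappa1 kappaP wv v0 alpha0 beta1 vP
  (@word_nil _ I) (@word_nil _ I).
apply/eqP; rewrite eq_le; apply/andP; split.
  apply: le_ereal_inf_tmp => _ [q q0 <-].
  exact: (pressureN_le hB hS hR kappa1 kappaP a0 holder wv v0 alpha0 beta1 vP Rp).
(* Any real [c] above the reflected pressure bounds the periodic sums of all large periods, and this
   bound is passed on to words. *)
apply: lee_of_real_gt => c /limsup_growth_lt[n0 rate].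
have [u wu walk_u] := transitive_path hB hS hR h Rp trN.
have [x [i0 Ii0 Jx] px] := psi_attains hS.
have s_i0 : step_of J psi i0 = -1 by rewrite -(psi_branch hB hS Ii0 Jx).
apply/lee_addgt0Pr => eps eps0.
have eps2 : 0 < eps / 2 by rewrite divr_gt0.
have [q q0 Pq] := tilted_pressure_le hB hS hR kappa1 kappaP a0 holder wv v0
  alpha0 beta1 vP Rp Ii0 s_i0 Ii wu walk_u rate Ij eps2.
rewrite -EFinD [eps]splitr addrA; apply: le_trans Pq.
by apply: ereal_inf_lbound; exists q.
Qed.
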